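(* Let $A,B$ be finite-dimensional quantum systems with $d=\min(d_A,d_B)\ge2$, let $|\psi\rangle=\sum_{i=1}^dC_i|i\rangle_A|i\rangle_B$ be a unit vector in Schmidt form with $C_i\ge0$, and put $p_i=C_i^2$. Then the maximum of the entanglement generation rate $\Gamma(\psi,H)$ over all Hermitian operators $H$ on $A\otimes B$ with energy variance $\langle\psi|H^2|\psi\rangle-\langle\psi|H|\psi\rangle^2=1$ is $$\max_H\Gamma(\psi,H)=2\sqrt{f(\vec p)},\qquad f(\vec p)=\sum_{i=1}^dp_i\log^2p_i-\Big(\sum_{i=1}^dp_i\log p_i\Big)^2,$$ i.e. $f(\vec p)$ is the variance of $\log p_i$ (the surprisal variance) with respect to the probability distribution $\{p_i\}_{i=1}^d$.
   Context: For a pure bipartite state $|\psi\rangle$ and a Hermitian $H$ on $A\otimes B$, $\Gamma(\psi,H):=\frac{d}{dt}E\big(e^{-iHt}|\psi\rangle\langle\psi|e^{iHt}\big)\big|_{t=0}$, where $E$ is the relative entropy of entanglement; on pure states it equals the entanglement entropy $-\mathrm{Tr}(\rho_A\log\rho_A)$, $\rho_A=\mathrm{Tr}_B|\psi\rangle\langle\psi|$. Logarithms are to a fixed base, and $0\log 0=0\log^2 0=0$. *)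

(* Defs.v *)
From mathcomp Require Import all_boot all_order all_algebra.
From mathcomp Require Import complex mxtens.
From mathcomp Require Import all_classical all_reals all_analysis.
Import numFieldNormedType.Exports.
Import Order.TTheory GRing.Theory Num.Theory.

Set Implicit Arguments.
Unset Strict Implicit.
Unset Printing Implicit Defensive.

Local Open Scope ring_scope.
Local Open Scope complex_scope.
Local Open Scope sesquilinear_scope.

(* Since [ln x = 0] for [x <= 0], the conventions 0 log 0 = 0 log^2 0 = 0
   hold automatically. *)
Definition logb (R : realType) (b x : R) : R := ln x / ln b.

Definition inner (R : realType) (n : nat) (u v : 'cV[R[i]]_n) : R[i] :=
  (u^t* *m v) 0 0.

Definition orthonormal_family (R : realType) (n d : nat)
    (a : 'I_d -> 'cV[R[i]]_n) : Prop :=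
  forall i j, inner (a i) (a j) = (i == j)%:R.

Definition dens (R : realType) (n : nat) (psi : 'cV[R[i]]_n) : 'M[R[i]]_n :=
  psi *m psi^t*.

(* Functional calculus f(A) = sum_k f(lambda_k) |e_k><e_k| of a Hermitian
   matrix A, where A = sum_k lambda_k |e_k><e_k| is a spectral decomposition.
   The eigenvalues are real; [complex.Re] only changes their type. *)
Definition funcalc (R : realType) (f : R -> R[i]) (n : nat)
    (A : 'M[R[i]]_n) : 'M[R[i]]_n :=
  invmx (spectralmx A)
    *m diag_mx (map_mx (fun z => f (complex.Re z)) (spectral_diag A))
    *m spectralmx A.

Definition mxlog (R : realType) (b : R) (n : nat) (A : 'M[R[i]]_n)
    : 'M[R[i]]_n :=
  funcalc (fun x => (logb b x)%:C) A.

(* e^{i s H} for Hermitian H. *)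
Definition expiH (R : realType) (n : nat) (s : R) (H : 'M[R[i]]_n)
    : 'M[R[i]]_n :=
  funcalc (fun x => cos (s * x) +i* sin (s * x)) H.

(* The basis vector |i>|j> of A (x) B has index [mxtens_index (i, j)], the
   convention of [tensmx]. *)
Definition ptraceB (R : realType) (dA dB : nat) (rho : 'M[R[i]]_(dA * dB))
    : 'M[R[i]]_dA :=
  \matrix_(i, i') \sum_(j < dB)
    rho (mxtens_index (i, j)) (mxtens_index (i', j)).

(* The entanglement E of a pure state rho, in units given by the base b; the
   trace is real, [complex.Re] only changes its type. *)
Definition entanglement (R : realType) (b : R) (dA dB : nat)
    (rho : 'M[R[i]]_(dA * dB)) : R :=
  let rhoA := ptraceB rho in - complex.Re (\tr (rhoA *m mxlog b rhoA)).

Definition evolve (R : realType) (n : nat) (H rho : 'M[R[i]]_n) (t : R)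
    : 'M[R[i]]_n :=
  expiH (- t) H *m rho *m expiH t H.

Definition entanglement_path (R : realType) (b : R) (dA dB : nat)
    (psi : 'cV[R[i]]_(dA * dB)) (H : 'M[R[i]]_(dA * dB)) : R -> R :=
  fun t => entanglement b (evolve H (dens psi) t).

Definition ent_rate (R : realType) (b : R) (dA dB : nat)
    (psi : 'cV[R[i]]_(dA * dB)) (H : 'M[R[i]]_(dA * dB)) : R :=
  derive1 (entanglement_path b psi H) 0.

Definition energy_variance (R : realType) (n : nat) (psi : 'cV[R[i]]_n)
    (H : 'M[R[i]]_n) : R[i] :=
  inner psi (H *m H *m psi) - inner psi (H *m psi) ^+ 2.

Definition surprisal_variance (R : realType) (b : R) (d : nat)
    (p : 'I_d -> R) : R :=
  \sum_(i < d) p i * logb b (p i) ^+ 2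
    - (\sum_(i < d) p i * logb b (p i)) ^+ 2.

(* Main.v *)
(** Near t = 0 the entropy is compared with its linearization without any
    perturbation theory of eigenvectors. Let A = Tr_B psi_t psi_t^* and
    B = Tr_B psi_0 psi_0^* have eigenvalues l_k, m_j and eigenvectors v_k, u_j.
    The overlaps w_kj = |<v_k|u_j>|^2 are doubly stochastic and
    Tr f(A) g(B) = sum w_kj f(l_k) g(m_j), hence
      S(A) - S(B) + Tr (A - B) ln B = sum w_kj D(l_k, m_j)
    with D(l, m) = - l (ln l - ln m) + l - m. If m > 0 then
    - (l - m)^2 / m <= D <= 0; if m = 0 then - l^2 <= D <= - l ln s + s for
    every s > 0. Since |A - B|^2 and the mass of A on ker B are O(t^2), the
    choice s = t^2 makes the error O(t^2 |ln t|), also for singular B.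
    So the rate is - Tr (A' ln B) = - 2 Im <phi|H psi> with
    phi = sum_i C_i log p_i |i>|i>. Removing from phi and from H psi their
    components along psi, Cauchy-Schwarz bounds it by 2 sqrt f, and
    H = i (|psi><v| - |v><psi|) with v the normalized component of phi
    orthogonal to psi attains the bound (any unit v orthogonal to psi if f = 0). *)
Require Import Defs.
From mathcomp Require Import all_boot all_order all_algebra.
From mathcomp Require Import complex mxtens.
From mathcomp Require Import all_classical all_reals all_analysis.
From mathcomp Require Import ring lra.
Import numFieldNormedType.Exports.
Import Order.TTheory GRing.Theory Num.Theory.
Set Implicit Arguments.
Unset Strict Implicit.
Unset Printing Implicit Defensive.
Local Open Scope ring_scope.
Local Open Scope complex_scope.
Local Open Scope sesquilinear_scope.
Local Open Scope classical_set_scope.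

(** * Squared moduli, spectral decompositions and the functional calculus *)

Definition nsq (R : realType) (z : R[i]) : R :=
  (complex.Re z) ^+ 2 + (complex.Im z) ^+ 2.

Lemma conjcE (R : realType) (z : R[i]) : Num.conj z = conjc z.
Proof. by []. Qed.

Lemma nsqE (R : realType) (z : R[i]) : (nsq z)%:C = z * z^*%C.
Proof. by rewrite /nsq add_Re2_Im2 sqr_normc. Qed.

Lemma nsqEC (R : realType) (z : R[i]) : (nsq z)%:C = z^*%C * z.
Proof. by rewrite nsqE mulrC. Qed.

Lemma nsq_ge0 (R : realType) (z : R[i]) : 0 <= nsq z.
Proof. by rewrite addr_ge0 // sqr_ge0. Qed.

Definition eigval (R : realType) (n : nat) (A : 'M[R[i]]_n) (k : 'I_n) : R :=
  complex.Re (spectral_diag A 0 k).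

(** The rows of [spectralmx] are adjoints of eigenvectors, so the entry inside [nsq] is
    <v_k|u_j>. *)
Definition overlap (R : realType) (n : nat) (A B : 'M[R[i]]_n) (k j : 'I_n) : R :=
  nsq ((spectralmx A *m (spectralmx B)^t*) k j).

Lemma adjmxM (R : realType) (m n p : nat) (A : 'M[R[i]]_(m, n))
    (B : 'M[R[i]]_(n, p)) : (A *m B)^t* = B^t* *m A^t*.
Proof. by rewrite trmx_mul map_mxM. Qed.

Lemma funcalcE (R : realType) (f : R -> R[i]) (n : nat) (A : 'M[R[i]]_n) :
  funcalc f A = (spectralmx A)^t*
    *m diag_mx (\row_k f (eigval A k)) *m spectralmx A.
Proof.
rewrite /funcalc (invmx_unitary (spectral_unitarymx A)).
have -> : map_mx (fun z => f (complex.Re z)) (spectral_diag A) =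
  \row_k f (eigval A k) by apply/rowP => k; rewrite !mxE.
by [].
Qed.

Lemma spectralmxKV (R : realType) (n : nat) (A : 'M[R[i]]_n) :
  spectralmx A *m (spectralmx A)^t* = 1%:M.
Proof. by apply/unitarymxP; rewrite spectral_unitarymx. Qed.

Lemma spectralmxVK (R : realType) (n : nat) (A : 'M[R[i]]_n) :
  (spectralmx A)^t* *m spectralmx A = 1%:M.
Proof. by apply: mulmx1C; exact: spectralmxKV. Qed.

Lemma funcalcM (R : realType) (f g : R -> R[i]) (n : nat) (A : 'M[R[i]]_n) :
  funcalc f A *m funcalc g A = funcalc (fun x => f x * g x) A.
Proof.
rewrite !funcalcE -!mulmxA (mulmxA (spectralmx A)) spectralmxKV mul1mx.
congr (_ *m _); rewrite mulmxA; congr (_ *m _).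
rewrite mulmx_diag; congr diag_mx.
by apply/rowP => k; rewrite !mxE.
Qed.

Lemma funcalc1 (R : realType) (n : nat) (A : 'M[R[i]]_n) :
  funcalc (fun=> 1) A = 1%:M.
Proof.
rewrite funcalcE (_ : \row__ _ = const_mx 1); last by apply/rowP => k; rewrite !mxE.
by rewrite diag_const_mx mulmx1 spectralmxVK.
Qed.

Lemma herm_spectralE (R : realType) (n : nat) (A : 'M[R[i]]_n) :
  A \is hermsymmx ->
  A = (spectralmx A)^t* *m diag_mx (\row_k (eigval A k)%:C) *m spectralmx A.
Proof.
move=> hA; have /orthomx_spectralP {1}-> := hermitian_normalmx hA.
rewrite (invmx_unitary (spectral_unitarymx A)).
have -> : \row_k (eigval A k)%:C = spectral_diag A.
  apply/rowP => k; rewrite mxE RRe_real; first by [].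
  by have /mxOverP := hermitian_spectral_diag_real hA; apply.
by [].
Qed.

Lemma funcalc_id (R : realType) (n : nat) (A : 'M[R[i]]_n) :
  A \is hermsymmx -> funcalc (fun x => x%:C) A = A.
Proof. by move=> hA; rewrite funcalcE -herm_spectralE. Qed.

Lemma funcalc_adj (R : realType) (f : R -> R[i]) (n : nat) (A : 'M[R[i]]_n) :
  (funcalc f A)^t* = funcalc (fun x => (f x)^*%C) A.
Proof.
rewrite !funcalcE !adjmxM trmxCK mulmxA; congr (_ *m _ *m _).
apply/matrixP => i j; rewrite !mxE eq_sym; case: eqP => [->|_].
  by rewrite !mulr1n conjcE.
by rewrite !mulr0n conjcE conjc0.
Qed.

(** In the eigenbasis, each coordinate of v vanishes unless its eigenvalue equals x. The particular
    basis chosen by [spectralmx] in a degenerate eigenspace is therefore irrelevant. *)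
Lemma funcalc_eigenvector (R : realType) (f : R -> R[i]) (n : nat)
    (A : 'M[R[i]]_n) (v : 'cV[R[i]]_n) (x : R) :
  A \is hermsymmx -> A *m v = x%:C *: v -> funcalc f A *m v = f x *: v.
Proof.
move=> hA Av; have [u uE] : exists u, u = spectralmx A *m v by exists (spectralmx A *m v).
have vE : v = (spectralmx A)^t* *m u by rewrite uE mulmxA spectralmxVK mul1mx.
rewrite funcalcE -!mulmxA -uE vE scalemxAr; congr (_ *m _).
have : diag_mx (\row_k (eigval A k)%:C) *m u = x%:C *: u.
  rewrite uE scalemxAr -Av {4}(herm_spectralE hA) !mulmxA spectralmxKV.
  by rewrite mul1mx.
move=> /colP dE; apply/colP => k; have := dE k.
rewrite !mul_diag_mx !mxE => /eqP.
rewrite -subr_eq0 -mulrBl mulf_eq0 subr_eq0 => /orP[|/eqP->]; last by rewrite !mulr0.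
by move=> /eqP/complexI ->.
Qed.

(** By cyclicity the trace is Tr D_f W D_g W^*, where W is the change of basis between the two
    eigenbases and D_f, D_g are diagonal. *)
Lemma mxtrace_funcalc2 (R : realType) (f g : R -> R) (n : nat) (A B : 'M[R[i]]_n) :
  \tr (funcalc (fun x => (f x)%:C) A *m funcalc (fun x => (g x)%:C) B) =
  (\sum_k \sum_j overlap A B k j * (f (eigval A k) * g (eigval B j)))%:C.
Proof.
rewrite !funcalcE -!mulmxA mxtrace_mulC -!mulmxA.
rewrite (mulmxA (spectralmx A)).
have -> : spectralmx B *m (spectralmx A)^t* = (spectralmx A *m (spectralmx B)^t*)^t*.
  by rewrite adjmxM trmxCK.
rewrite /overlap; move: (spectralmx A *m _) => W.
rewrite rmorph_sum; apply: eq_bigr => k _.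
rewrite mul_diag_mx !mxE rmorph_sum /= mulr_sumr; apply: eq_bigr => j _.
rewrite mul_diag_mx !mxE !rmorphM /= nsqE conjcE /=; ring.
Qed.

(** With S diagonalizing M M^*, the eigenvalue is a diagonal entry of (S M)(S M)^*, a sum of squared
    moduli. *)
Lemma eigval_gram_ge0 (R : realType) (m n : nat) (M : 'M[R[i]]_(m, n)) k :
  0 <= eigval (M *m M^t*) k.
Proof.
have hA : M *m M^t* \is hermsymmx.
  by apply/is_hermitianmxP; rewrite expr0 scale1r adjmxM trmxCK.
have := herm_spectralE hA; set A := M *m M^t*; set S := spectralmx A => AE.
have : (S *m M) *m (S *m M)^t* = diag_mx (\row_k (eigval A k)%:C).
  rewrite adjmxM mulmxA -(mulmxA S) -/A {1}AE !mulmxA spectralmxKV mul1mx.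
  by rewrite -mulmxA spectralmxKV mulmx1.
move=> /matrixP /(_ k k); rewrite !mxE eqxx mulr1n => /esym E.
rewrite -ler0c E; apply: sumr_ge0 => i _; rewrite !mxE conjcE; exact: mulcJ_ge0.
Qed.

(** * Overlap-weighted sums over pairs of eigenvalues, and Frobenius norms *)

Lemma overlap_ge0 (R : realType) (n : nat) (A B : 'M[R[i]]_n) k j :
  0 <= overlap A B k j.
Proof. exact: nsq_ge0. Qed.

Definition wsum (R : realType) (n : nat) (A B : 'M[R[i]]_n) (h : R -> R -> R) : R :=
  \sum_k \sum_j overlap A B k j * h (eigval A k) (eigval B j).

Lemma wsumD (R : realType) (n : nat) (A B : 'M[R[i]]_n) (g h : R -> R -> R) :
  wsum A B (fun l m => g l m + h l m) = wsum A B g + wsum A B h.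
Proof.
rewrite -big_split; apply: eq_bigr => k _; rewrite -big_split.
by apply: eq_bigr => j _; rewrite mulrDr.
Qed.

Lemma wsumZ (R : realType) (n : nat) (A B : 'M[R[i]]_n) c (h : R -> R -> R) :
  wsum A B (fun l m => c * h l m) = c * wsum A B h.
Proof.
rewrite /wsum mulr_sumr; apply: eq_bigr => k _; rewrite mulr_sumr.
by apply: eq_bigr => j _; rewrite mulrCA.
Qed.

(** Comparing only at actual eigenvalues leaves their signs available for the scalar estimates. *)
Lemma ler_wsum (R : realType) (n : nat) (A B : 'M[R[i]]_n) (g h : R -> R -> R) :
  (forall k j, g (eigval A k) (eigval B j) <= h (eigval A k) (eigval B j)) ->
  wsum A B g <= wsum A B h.
Proof.
move=> gh; apply: ler_sum => k _; apply: ler_sum => j _.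
by rewrite ler_wpM2l // overlap_ge0.
Qed.

Definition frobsq (R : realType) (m n : nat) (M : 'M[R[i]]_(m, n)) : R :=
  \sum_i \sum_j nsq (M i j).

Lemma frobsqE (R : realType) (m n : nat) (M : 'M[R[i]]_(m, n)) :
  (frobsq M)%:C = \tr (M *m M^t*).
Proof.
rewrite rmorph_sum; apply: eq_bigr => i _; rewrite rmorph_sum mxE.
by apply: eq_bigr => j _; rewrite !mxE; exact: nsqE.
Qed.

Lemma frobsq_ge0 (R : realType) (m n : nat) (M : 'M[R[i]]_(m, n)) : 0 <= frobsq M.
Proof. by apply: sumr_ge0 => i _; apply: sumr_ge0 => j _; exact: nsq_ge0. Qed.

Lemma frobsq_eq0 (R : realType) (m n : nat) (M : 'M[R[i]]_(m, n)) :
  frobsq M = 0 -> M = 0.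
Proof.
move=> M0; apply/matrixP => i j; rewrite mxE.
have/psumr_eq0P := M0 => /(_ _ i isT) M1.
have/psumr_eq0P : \sum_j nsq (M i j) = 0.
  by apply: M1 => k _; apply: sumr_ge0 => l _; exact: nsq_ge0.
move=> /(_ _ j isT) M2; have : nsq (M i j) = 0 by apply: M2 => k _; exact: nsq_ge0.
move/eqP; rewrite /nsq paddr_eq0 ?sqr_ge0 // !sqrf_eq0 => /andP[/eqP a0 /eqP b0].
by apply/eqP; rewrite eq_complex a0 b0 !eqxx.
Qed.

(** * Entropy and its linearization *)

Definition hlog (R : realType) (n : nat) (A : 'M[R[i]]_n) : 'M[R[i]]_n :=
  funcalc (fun x => (ln x)%:C) A.

Definition vnentropy (R : realType) (n : nat) (A : 'M[R[i]]_n) : R :=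
  - complex.Re (\tr (A *m hlog A)).

Lemma Re_tr_wsum (R : realType) (n : nat) (A B : 'M[R[i]]_n) (f g : R -> R) :
  complex.Re (\tr (funcalc (fun x => (f x)%:C) A *m funcalc (fun x => (g x)%:C) B))
  = wsum A B (fun l m => f l * g m).
Proof. by rewrite mxtrace_funcalc2. Qed.

(** Writing the identity as [funcalc (fun=> 1) B] turns the trace into a double sum, which encodes
    that the overlaps sum to 1 over j. *)
Lemma wsum_left (R : realType) (n : nat) (A B : 'M[R[i]]_n) (f : R -> R) :
  wsum A B (fun l _ => f l) = complex.Re (\tr (funcalc (fun x => (f x)%:C) A)).
Proof.
rewrite -[funcalc _ A]mulmx1 -(funcalc1 B).
rewrite (Re_tr_wsum A B f (fun=> 1)).
by apply: eq_bigr => k _; apply: eq_bigr => j _; rewrite mulr1.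
Qed.

Lemma wsum_right (R : realType) (n : nat) (A B : 'M[R[i]]_n) (f : R -> R) :
  wsum A B (fun _ m => f m) = complex.Re (\tr (funcalc (fun x => (f x)%:C) B)).
Proof.
rewrite -[funcalc _ B]mul1mx -(funcalc1 A).
rewrite (Re_tr_wsum A B (fun=> 1) f).
by apply: eq_bigr => k _; apply: eq_bigr => j _; rewrite mul1r.
Qed.

Lemma funcalcMr (R : realType) (f g : R -> R) (n : nat) (A : 'M[R[i]]_n) :
  funcalc (fun x => (f x)%:C) A *m funcalc (fun x => (g x)%:C) A =
  funcalc (fun x => (f x * g x)%:C) A.
Proof.
rewrite funcalcM.
have -> // : (fun x => (f x)%:C * (g x)%:C) = fun x => (f x * g x)%:C.
by apply/funext => x; rewrite rmorphM.
Qed.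

Lemma gram_herm (R : realType) (m n : nat) (M : 'M[R[i]]_(m, n)) :
  M *m M^t* \is hermsymmx.
Proof. by apply/is_hermitianmxP; rewrite expr0 scale1r adjmxM trmxCK. Qed.

Lemma hermE (R : realType) (n : nat) (A : 'M[R[i]]_n) :
  A \is hermsymmx -> A^t* = A.
Proof. by move=> /is_hermitianmxP; rewrite expr0 scale1r. Qed.

Lemma RecD (R : realType) (x y : R[i]) : complex.Re (x + y) = complex.Re x + complex.Re y.
Proof. by case: x; case: y. Qed.

Lemma RecN (R : realType) (x : R[i]) : complex.Re (- x) = - complex.Re x.
Proof. by case: x. Qed.

Lemma RecB (R : realType) (x y : R[i]) : complex.Re (x - y) = complex.Re x - complex.Re y.
Proof. by rewrite RecD RecN. Qed.

(** For m > 0 this is minus the Bregman divergence of x ln x. At m = 0 the convention ln 0 = 0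
    leaves - l ln l + l. *)
Definition bregman (R : realType) (l m : R) : R := - (l * (ln l - ln m)) + l - m.

(** Equal traces make the weighted sum of l - m vanish. Adding it cancels the first-order term of -
    l (ln l - ln m) at l = m when m > 0. *)
Lemma vnentropy_expansion (R : realType) (n : nat) (A B : 'M[R[i]]_n) :
  A \is hermsymmx -> B \is hermsymmx -> \tr A = \tr B ->
  vnentropy A - vnentropy B + complex.Re (\tr ((A - B) *m hlog B)) =
  wsum A B (@bregman R).
Proof.
move=> hA hB trAB.
have E1 : complex.Re (\tr (A *m hlog A)) = wsum A B (fun l _ => l * ln l).
  by rewrite (wsum_left A B (fun l => l * ln l)) -funcalcMr funcalc_id.
have E2 : complex.Re (\tr (A *m hlog B)) = wsum A B (fun l m => l * ln m).
  by rewrite -(Re_tr_wsum A B id) funcalc_id.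
have E3 : wsum A B (fun l _ => l) = wsum A B (fun _ m => m).
  by rewrite (wsum_left A B id) (wsum_right A B id) !funcalc_id // trAB.
have -> : @bregman R = fun l m => -1 * (l * ln l) + l * ln m + l + -1 * m.
  by apply/funext => l; apply/funext => m; rewrite /bregman; ring.
rewrite !wsumD !wsumZ -E1 -E2 -E3 /vnentropy mulmxBl linearB RecB /=.
have alg (x y z u : R) : - x - - z + (y - z) = -1 * x + y + u + -1 * u by ring.
exact: alg.
Qed.

(** * Scalar bounds on the divergence *)

Lemma ln_le_subr1 (R : realType) (x : R) : 0 < x -> ln x <= x - 1.
Proof. by move=> x0; have := @le_ln1Dx R (x - 1); rewrite (addrC 1) subrK; apply; lra. Qed.

(** For l, m > 0, ln (l / m) <= l / m - 1 gives the bound with K = 1 / m. At m = 0, where 0^-1 = 0,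
    the condition 1 <= K takes over through ln l <= l - 1. *)
Lemma bregman_ge (R : realType) (K l m : R) : 0 <= l -> 0 <= m -> 1 <= K -> m^-1 <= K ->
  - (K * (l - m) ^+ 2) <= bregman l m.
Proof.
rewrite le_eqVlt => /orP[/eqP<-|l0]; rewrite le_eqVlt => /orP[/eqP<-|m0] K1 Km.
- by rewrite /bregman !mul0r subrr expr0n /= mulr0 !oppr0 !addr0.
- rewrite /bregman mul0r oppr0 !sub0r sqrrN !add0r lerN2.
  suff: 1 <= K * m by move=> ?; rewrite expr2 mulrA ler_peMl // ltW.
  by rewrite -ler_pdivrMr // mul1r.
- rewrite /bregman (@ln0 R 0) // !subr0.
  have := ln_le_subr1 l0; have : 0 <= (K - 1) * l ^+ 2 by rewrite mulr_ge0 ?sqr_ge0 ?subr_ge0.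
  by nra.
have E : ln l - ln m = ln (l / m) by rewrite ln_div.
have := @ln_le_subr1 R (l / m) (divr_gt0 l0 m0); rewrite /bregman E => H.
have H2 : 0 <= (K - m^-1) * (l - m) ^+ 2 by rewrite mulr_ge0 ?sqr_ge0 ?subr_ge0.
have H3 : l * ln (l / m) <= l * (l / m - 1) by rewrite ler_pM2l.
have H4 : m^-1 * (l - m) ^+ 2 = l * (l / m) - 2 * l + m by field; lra.
by nra.
Qed.

Lemma bregman_le (R : realType) (s l m : R) : 0 <= l -> 0 <= m -> 0 < s ->
  bregman l m <= - ln s * (l * (m == 0)%:R) + s.
Proof.
move=> + + s0; rewrite le_eqVlt => /orP[/eqP<-|l0].
  by move=> m0; rewrite /bregman !mul0r mulr0 oppr0 !add0r; lra.
(* Applied with c = m when m > 0 and with c = s when m = 0, so the factor - ln s is paid only on the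
   kernel. *)
have key c : 0 < c -> - (l * (ln l - ln c)) + l <= c.
  move=> c0; have := @ln_le_subr1 R (c / l) (divr_gt0 c0 l0); rewrite ln_div // => H.
  have : l * (ln c - ln l) <= l * (c / l - 1) by rewrite ler_pM2l.
  have -> : l * (c / l - 1) = c - l by field; lra.
  by lra.
rewrite le_eqVlt => /orP[/eqP<-|m0].
  rewrite eqxx mulr1 /bregman (@ln0 R 0) // subr0.
  have := key _ s0; lra.
rewrite gt_eqF // !mulr0 add0r /bregman; have := key _ m0; lra.
Qed.

Lemma ImcD (R : realType) (x y : R[i]) : complex.Im (x + y) = complex.Im x + complex.Im y.
Proof. by case: x; case: y. Qed.

Lemma RecM (R : realType) (x y : R[i]) :
  complex.Re (x * y) = complex.Re x * complex.Re y - complex.Im x * complex.Im y.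
Proof. by case: x; case: y. Qed.

Lemma ImcM (R : realType) (x y : R[i]) :
  complex.Im (x * y) = complex.Re x * complex.Im y + complex.Im x * complex.Re y.
Proof. by case: x; case: y => a b c d /=; rewrite addrC. Qed.

Lemma ImcB (R : realType) (x y : R[i]) : complex.Im (x - y) = complex.Im x - complex.Im y.
Proof. by case: x; case: y. Qed.

(** * Frobenius distance and the mass on a kernel *)

Lemma funcalc_idM (R : realType) (n : nat) (A : 'M[R[i]]_n) :
  A \is hermsymmx -> funcalc (fun x => (x * x)%:C) A = A *m A.
Proof. by move=> hA; rewrite -(funcalcMr id id) funcalc_id. Qed.

(** Expanding the square yields Tr A^2 - 2 Tr A B + Tr B^2. *)
Lemma wsum_sqr_dist (R : realType) (n : nat) (A B : 'M[R[i]]_n) :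
  A \is hermsymmx -> B \is hermsymmx ->
  wsum A B (fun l m => (l - m) ^+ 2) = frobsq (A - B).
Proof.
move=> hA hB; apply: complexI; rewrite frobsqE.
have -> : (A - B)^t* = A - B.
  by rewrite linearB /= map_mxB (hermE hA) (hermE hB).
have -> : (fun l m : R => (l - m) ^+ 2) = fun l m => l * l + -2 * (l * m) + m * m.
  by apply/funext => l; apply/funext => m; ring.
rewrite !wsumD wsumZ (wsum_left A B (fun l => l * l)).
rewrite (wsum_right A B (fun m => m * m)) -(Re_tr_wsum A B id id).
rewrite !funcalc_idM // !funcalc_id //.
(* [wsum] yields only real parts; these traces are real, so the identity can be checked in
   [R[i]]. *)
have re_tr (P Q : 'M[R[i]]_n) : P \is hermsymmx -> Q \is hermsymmx ->
    (complex.Re (\tr (P *m Q)))%:C = \tr (P *m Q).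
  by move=> hP hQ; rewrite -(funcalc_id hP) -(funcalc_id hQ) mxtrace_funcalc2.
rewrite !rmorphD rmorphM /= !re_tr // rmorphN rmorph_nat.
have trB (P Q : 'M[R[i]]_n) : \tr (P - Q) = \tr P - \tr Q by exact: linearB.
rewrite mulmxBr !trB !mulmxBl !trB (mxtrace_mulC B A).
have alg (x y z : R[i]) : x + -2 * y + z = x - y - (y - z) by ring.
exact: alg.
Qed.

Definition kerproj (R : realType) (n : nat) (A : 'M[R[i]]_n) : 'M[R[i]]_n :=
  funcalc (fun x => ((x == 0)%:R)%:C) A.

Lemma kerproj_gram (R : realType) (m n : nat) (M : 'M[R[i]]_(m, n)) :
  kerproj (M *m M^t*) *m M = 0.
Proof.
apply: frobsq_eq0; apply: complexI; rewrite frobsqE adjmxM.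
set P := kerproj _; rewrite mulmxA -(mulmxA P) -{1}(funcalc_id (gram_herm M)).
rewrite /P /kerproj funcalcM.
have -> : (fun x : R => ((x == 0)%:R)%:C * x%:C) = fun=> 0%:C.
  by apply/funext => x; case: eqP => [->|_]; rewrite ?rmorph0 ?mulr0 ?mul0r.
have -> : funcalc (fun=> 0%:C) (M *m M^t*) = 0.
  rewrite funcalcE (_ : \row__ _ = 0); last by apply/rowP => k; rewrite !mxE.
  by rewrite linear0 mulmx0 mul0mx.
by rewrite mul0mx linear0.
Qed.

Lemma kerproj_adj (R : realType) (n : nat) (A : 'M[R[i]]_n) :
  (kerproj A)^t* = kerproj A.
Proof.
rewrite /kerproj funcalc_adj.
have -> // : (fun x : R => @conjc R ((x == 0)%:R)%:C) = fun x => ((x == 0)%:R)%:C.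
by apply/funext => x; exact: conjc_real.
Qed.

(** The projection P kills N on both sides, so M may be replaced by M - N; then P <= 1. The mass is
    thus quadratic in M - N, which controls the logarithmic singularity at a singular N N^*. *)
Lemma kerproj_gram_mass (R : realType) (m n : nat) (M N : 'M[R[i]]_(m, n)) :
  complex.Re (\tr (M *m M^t* *m kerproj (N *m N^t*))) <= frobsq (M - N).
Proof.
set P := kerproj _; pose D := M - N.
have PN : P *m N = 0 by exact: kerproj_gram.
have NP : N^t* *m P = 0 by rewrite -[P]kerproj_adj -adjmxM PN trmx0 map_mx0.
have -> : \tr (M *m M^t* *m P) = \tr (D *m D^t* *m P).
  have -> : M = D + N by rewrite subrK.
  rewrite linearD /= map_mxD mulmxDr !mulmxDl -!mulmxA NP !mulmx0 !addr0.
  by rewrite linearD /= (mxtrace_mulC N) -mulmxA PN mulmx0 linear0 addr0.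
rewrite -{1}(funcalc_id (gram_herm D)) (Re_tr_wsum _ _ id).
have -> : frobsq D = complex.Re (\tr (D *m D^t*)) by rewrite -frobsqE.
rewrite -{2}(funcalc_id (gram_herm D)) -(wsum_left _ (N *m N^t*) id).
apply: ler_wsum => k j; rewrite /=.
by case: eqP => _; rewrite ?mulr1 ?mulr0 ?eigval_gram_ge0.
Qed.

(** The constant depends on N alone, so it is uniform along a path M = F t, while s remains free to
    vary with t. *)
Lemma vnentropy_gram_bounds (R : realType) (m n : nat) (N : 'M[R[i]]_(m, n)) :
  exists2 K : R, 0 <= K & forall (M : 'M[R[i]]_(m, n)) (s : R),
    let A := M *m M^t* in let B := N *m N^t* in
    \tr A = \tr B -> 0 < s -> s <= 1 ->
    - (K * frobsq (A - B)) <=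
      vnentropy A - vnentropy B + complex.Re (\tr ((A - B) *m hlog B)) <=
      - ln s * frobsq (M - N) + m%:R * s.
Proof.
pose B := N *m N^t*.
have B0 k : 0 <= eigval B k := eigval_gram_ge0 N k.
have s0 : 0 <= \sum_j (eigval B j)^-1 by apply: sumr_ge0 => j _; rewrite invr_ge0.
(* With 0^-1 = 0 this dominates 1 and the inverse of every nonzero eigenvalue of B. *)
exists (1 + \sum_j (eigval B j)^-1); first by rewrite addr_ge0.
move=> M s A B1; rewrite {}/B1 -/B => trAB sgt0 sle1.
have A0 k : 0 <= eigval A k := eigval_gram_ge0 M k.
rewrite (vnentropy_expansion (gram_herm M) (gram_herm N) trAB).
apply/andP; split.
  rewrite -wsum_sqr_dist ?gram_herm // -mulNr -wsumZ; apply: ler_wsum => k j.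
  rewrite mulNr; apply: bregman_ge => //; first by rewrite lerDl.
  rewrite (bigD1 j) //= addrCA lerDl addr_ge0 //.
  by apply: sumr_ge0 => l _; rewrite invr_ge0.
apply: (@le_trans _ _ (wsum A B (fun l m => - ln s * (l * (m == 0)%:R) + s))).
  by apply: ler_wsum => k j; apply: bregman_le.
rewrite wsumD wsumZ (wsum_left A B (fun=> s)).
rewrite -(Re_tr_wsum A B id (fun m => (m == 0)%:R)) (funcalc_id (gram_herm M)).
(* The constant s contributes Tr (s 1), which is the term [m%:R * s]. *)
have -> : funcalc (fun=> s%:C) A = s%:C%:M.
  rewrite funcalcE; have -> : \row_k s%:C = const_mx s%:C :> 'rV[R[i]]_m.
    by apply/rowP => k; rewrite !mxE.
  by rewrite diag_const_mx mul_mx_scalar -scalemxAl spectralmxVK scalemx1.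
rewrite mxtrace_scalar lerD //.
  by rewrite ler_wpM2l ?oppr_ge0 ?ln_le0 // kerproj_gram_mass.
by rewrite raddfMn /= mulr_natl.
Qed.

(** * Derivatives at 0 of real, complex and matrix-valued functions *)

Lemma is_derive_lipschitz_at0 (R : realType) (f : R -> R) (l : R) :
  is_derive (0 : R) 1 f l ->
  exists2 K : R, 0 <= K & \forall t \near 0^', `|f t - f 0| <= K * `|t|.
Proof.
move=> [df _]; have /cvg_ex[/= d fd] := df.
exists (`|d| + 1); first by rewrite addr_ge0.
have lt1 : `|d| < `|d| + 1 by rewrite ltrDl.
have H := cvgr_norm_le _ fd _ lt1.
near=> t; have t0 : t != 0 by near: t; exact: nbhs_dnbhs_neq.
have : `|t^-1 *: (f (t *: (1 : R) + 0) - f 0)| <= `|d| + 1.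
  by near: t; exact: H.
have -> : t *: (1 : R) + 0 = t by rewrite addr0; exact: mulr1.
rewrite normrZ normfV ler_pdivrMl ?normr_gt0 //.
by rewrite mulrC.
Unshelve. all: by end_near. Qed.

(** The power |t|^(3/2) is o(t), yet large enough near 0 to absorb t^2 |ln t|. *)
Lemma is_derive_of_little_o (R : realType) (r : R -> R) (K : R) :
  r 0 = 0 -> (\forall t \near 0^', `|r t| <= K * (`|t| * Num.sqrt `|t|)) ->
  is_derive (0 : R) 1 r 0.
Proof.
move=> r0 rK.
have cv : h^-1 *: (r (h *: (1 : R) + 0) - r 0) @[h --> (0 : R)^'] --> (0 : R).
  apply/norm_cvg0P.
  apply: (@squeeze_cvgr _ _ _ _ (fun=> 0) (fun h => K * Num.sqrt `|h|)).
  - near=> h; rewrite normr_ge0 /= r0 subr0.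
    have -> : h *: (1 : R) + 0 = h by rewrite addr0; exact: mulr1.
    rewrite normrZ normfV.
    have h0 : h != 0 by near: h; exact: nbhs_dnbhs_neq.
    rewrite ler_pdivrMl ?normr_gt0 // mulrCA.
    by near: h; exact: rK.
  - exact: cvg_cst.
  - suff: K * Num.sqrt `|h| @[h --> (0 : R)^'] --> K * Num.sqrt `|(0 : R)|.
      by rewrite normr0 sqrtr0 mulr0.
    apply: cvg_within_filter.
    apply: cvgM; first exact: cvg_cst.
    apply: continuous_comp; first exact: norm_continuous.
    exact: sqrt_continuous.
apply: DeriveDef; last exact: cvg_lim cv.
by apply/cvg_ex; exists 0.
Unshelve. all: by end_near. Qed.

(** Differentiating real and imaginary parts separately keeps every limit in [R]. *)
Definition cderiv (R : realType) (f : R -> R[i]) (l : R[i]) : Prop :=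
  is_derive (0 : R) 1 (fun t => complex.Re (f t)) (complex.Re l) /\
  is_derive (0 : R) 1 (fun t => complex.Im (f t)) (complex.Im l).

Lemma cderiv_cst (R : realType) (c : R[i]) : cderiv (fun=> c) 0.
Proof. by split; exact: is_derive_cst. Qed.

Lemma cderivD (R : realType) (f g : R -> R[i]) (a b : R[i]) :
  cderiv f a -> cderiv g b -> cderiv (fun t => f t + g t) (a + b).
Proof.
move=> [fr fi] [gr gi]; split; rewrite ?RecD ?ImcD.
  by under eq_fun do rewrite RecD; exact: (is_deriveD fr gr).
by under eq_fun do rewrite ImcD; exact: (is_deriveD fi gi).
Qed.

Lemma cderivM (R : realType) (f g : R -> R[i]) (a b : R[i]) :
  cderiv f a -> cderiv g b -> cderiv (fun t => f t * g t) (a * g 0 + f 0 * b).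
Proof.
move=> [fr fi] [gr gi]; split.
  under eq_fun do rewrite RecM.
  apply: (is_derive_eq (is_deriveB (is_deriveM fr gr) (is_deriveM fi gi))).
  by rewrite !(RecD, RecM) /GRing.scale /=; ring.
under eq_fun do rewrite ImcM.
apply: (is_derive_eq (is_deriveD (is_deriveM fr gi) (is_deriveM fi gr))).
by rewrite !(ImcD, ImcM) /GRing.scale /=; ring.
Qed.

Lemma cderiv_conj (R : realType) (f : R -> R[i]) (a : R[i]) :
  cderiv f a -> cderiv (fun t => Num.conj (f t)) (Num.conj a).
Proof.
have Rec (z : R[i]) : complex.Re (Num.conj z) = complex.Re z by case: z.
have Imc (z : R[i]) : complex.Im (Num.conj z) = - complex.Im z by case: z.
move=> [fr fi]; split; rewrite ?Rec ?Imc.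
  by under eq_fun do rewrite Rec.
by under eq_fun do rewrite Imc; exact: (is_deriveN fi).
Qed.

Lemma cderiv_sum (R : realType) (n : nat) (f : 'I_n -> R -> R[i]) (a : 'I_n -> R[i]) :
  (forall k, cderiv (f k) (a k)) -> cderiv (fun t => \sum_k f k t) (\sum_k a k).
Proof.
elim: n f a => [|n IHn] f a fa.
  by under eq_fun do rewrite big_ord0; rewrite big_ord0; exact: cderiv_cst.
under eq_fun do rewrite big_ord_recl; rewrite big_ord_recl.
by apply: cderivD => //; apply: (IHn (fun k => f (lift ord0 k))).
Qed.

Definition mxderiv (R : realType) (m n : nat) (F : R -> 'M[R[i]]_(m, n))
    (D : 'M[R[i]]_(m, n)) : Prop :=
  forall i j, cderiv (fun t => F t i j) (D i j).

Lemma mxderiv_cst (R : realType) (m n : nat) (A : 'M[R[i]]_(m, n)) :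
  mxderiv (fun=> A) 0.
Proof. by move=> i j; rewrite mxE; exact: cderiv_cst. Qed.

Lemma mxderivM (R : realType) (m n p : nat) (F : R -> 'M[R[i]]_(m, n))
    (G : R -> 'M[R[i]]_(n, p)) A B :
  mxderiv F A -> mxderiv G B ->
  mxderiv (fun t => F t *m G t) (A *m G 0 + F 0 *m B).
Proof.
move=> FA GB i j; under eq_fun do rewrite mxE.
rewrite !mxE -big_split /=; apply: cderiv_sum => k; exact: cderivM.
Qed.

Lemma mxderivMl (R : realType) (m n p : nat) (A : 'M[R[i]]_(m, n))
    (G : R -> 'M[R[i]]_(n, p)) B :
  mxderiv G B -> mxderiv (fun t => A *m G t) (A *m B).
Proof.
by move=> GB; have := mxderivM (mxderiv_cst A) GB; rewrite mul0mx add0r.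
Qed.

Lemma mxderivMr (R : realType) (m n p : nat) (F : R -> 'M[R[i]]_(m, n))
    (B : 'M[R[i]]_(n, p)) A :
  mxderiv F A -> mxderiv (fun t => F t *m B) (A *m B).
Proof.
by move=> FA; have := mxderivM FA (mxderiv_cst B); rewrite mulmx0 addr0.
Qed.

Lemma mxderiv_adj (R : realType) (m n : nat) (F : R -> 'M[R[i]]_(m, n)) A :
  mxderiv F A -> mxderiv (fun t => (F t)^t*) (A^t*).
Proof.
by move=> FA i j; under eq_fun do rewrite !mxE; rewrite !mxE; exact: cderiv_conj.
Qed.

Lemma mxderiv_trace (R : realType) (n : nat) (F : R -> 'M[R[i]]_n) A :
  mxderiv F A -> cderiv (fun t => \tr (F t)) (\tr A).
Proof. by move=> FA; apply: (cderiv_sum (f := fun k t => F t k k)). Qed.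

Lemma mxderiv_lipschitz_at0 (R : realType) (m n : nat) (F : R -> 'M[R[i]]_(m, n)) A :
  mxderiv F A ->
  exists2 K : R, 0 <= K & \forall t \near 0^', frobsq (F t - F 0) <= K * t ^+ 2.
Proof.
move=> FA.
(* A sigma type selects one constant per entry, so that the constants can be summed into a global
   one. *)
have entry (ij : 'I_m * 'I_n) : {K : R | 0 <= K /\
    \forall t \near 0^', nsq ((F t - F 0) ij.1 ij.2) <= K * t ^+ 2}.
  apply: cid; have [fr fi] := FA ij.1 ij.2.
  have [K K0 HK] := is_derive_lipschitz_at0 fr.
  have [L L0 HL] := is_derive_lipschitz_at0 fi.
  exists (K ^+ 2 + L ^+ 2); split; first by rewrite addr_ge0 ?sqr_ge0.
  near=> t; rewrite !mxE /nsq !RecB ImcB mulrDl -!exprMn.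
  apply: lerD; rewrite -real_normK ?num_real // -(real_normK (num_real (_ * _))).
    rewrite lerXn2r ?nnegrE // normrM (ger0_norm K0); near: t; exact: HK.
  rewrite lerXn2r ?nnegrE // normrM (ger0_norm L0); near: t; exact: HL.
exists (\sum_i \sum_j sval (entry (i, j))).
  by apply: sumr_ge0 => i _; apply: sumr_ge0 => j _; case: (entry _) => ? [].
have : \forall t \near 0^', forall ij : 'I_m * 'I_n,
    nsq ((F t - F 0) ij.1 ij.2) <= sval (entry ij) * t ^+ 2.
  by apply: filter_forall => ij; case: (entry ij) => ? [].
apply: filterS => t Ht; rewrite /frobsq mulr_suml; apply: ler_sum => i _.
by rewrite mulr_suml; apply: ler_sum => j _; exact: (Ht (i, j)).
Unshelve. all: by end_near. Qed.

(** * Derivative of the entropy along a path of Gram matrices *)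

Lemma neg_ln_sqr_le (R : realType) (t : R) : t != 0 ->
  - ln (t ^+ 2) * (t ^+ 2) <= 4 * (`|t| * Num.sqrt `|t|).
Proof.
move=> t0; pose u := Num.sqrt `|t|.
have u0 : 0 < u by rewrite sqrtr_gt0 normr_gt0.
have tu : `|t| = u ^+ 2 by rewrite sqr_sqrtr.
(* With u = |t|^(1/2), - ln (u^4) = 4 (- ln u) <= 4 / u, and u^4 / u = |t|^(3/2). *)
have -> : t ^+ 2 = u ^+ 4 by rewrite -real_normK ?num_real // tu -exprM.
rewrite -/u tu lnXn // -exprSr.
have := @ln_le_subr1 R u^-1; rewrite invr_gt0 lnV // => /(_ u0) H.
have H1 : - ln u <= u^-1 by lra.
have -> : 4 * u ^+ 3 = 4 * (u^-1 * u ^+ 4) by field; lra.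
have : (- ln u) * u ^+ 4 <= u^-1 * u ^+ 4 by rewrite ler_wpM2r // exprn_ge0 // ltW.
lra.
Qed.

(** Only F is differentiated, never its eigenvectors. The constant trace is what allows the
    expansion at every t. *)
Lemma is_derive_vnentropy_gram (R : realType) (m n : nat)
    (F : R -> 'M[R[i]]_(m, n)) (D : 'M[R[i]]_(m, n)) :
  mxderiv F D -> (forall t, \tr (F t *m (F t)^t*) = \tr (F 0 *m (F 0)^t*)) ->
  is_derive (0 : R) 1 (fun t => vnentropy (F t *m (F t)^t*))
    (- complex.Re (\tr ((D *m (F 0)^t* + F 0 *m D^t*)
                          *m hlog (F 0 *m (F 0)^t*)))).
Proof.
move=> FD trF; pose X t := F t *m (F t)^t*.
have XD : mxderiv X (D *m (F 0)^t* + F 0 *m D^t*).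
  exact: (mxderivM FD (mxderiv_adj FD)).
pose g t := complex.Re (\tr (X t *m hlog (X 0))).
pose r t := vnentropy (X t) - vnentropy (X 0)
  + complex.Re (\tr ((X t - X 0) *m hlog (X 0))).
have r0 : r 0 = 0 by rewrite /r !subrr mul0mx linear0 addr0.
have [K K0 HK] := vnentropy_gram_bounds (F 0).
have [L L0 HL] := mxderiv_lipschitz_at0 FD.
have [M M0 HM] := mxderiv_lipschitz_at0 XD.
have rd : is_derive (0 : R) 1 r 0.
  (* K * M comes from the lower bound; 4 * L from the logarithmic term of the upper bound and [m%:R]
     from its last term, both taken at s = t^2. *)
  apply: (@is_derive_of_little_o _ r (K * M + (4 * L + m%:R))) => //.
  near=> t.
  have t0 : t != 0 by near: t; exact: nbhs_dnbhs_neq.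
  have t1 : `|t| <= 1.
    near: t; apply: dnbhs0_le; exact: ltr01.
  have s0 : 0 < t ^+ 2 by rewrite exprn_even_gt0.
  have s1 : t ^+ 2 <= 1 by rewrite -real_normK ?num_real // expr_le1.
  have /andP[lo hi] : - (K * frobsq (X t - X 0)) <= r t <=
      - ln (t ^+ 2) * frobsq (F t - F 0) + m%:R * t ^+ 2.
    exact: HK (F t) (t ^+ 2) (trF t) s0 s1.
  have Lt : frobsq (F t - F 0) <= L * t ^+ 2 by near: t; exact: HL.
  have Mt : frobsq (X t - X 0) <= M * t ^+ 2 by near: t; exact: HM.
  have tt : t ^+ 2 <= `|t| * Num.sqrt `|t|.
    rewrite -real_normK ?num_real // expr2 ler_wpM2l //.
    rewrite -{1}(sqr_sqrtr (normr_ge0 t)) expr2 ler_piMl ?sqrtr_ge0 //.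
    by rewrite -sqrtr1 ler_wsqrtr.
  have tl := neg_ln_sqr_le t0.
  move: (r t) lo hi => rt lo hi.
  move: (frobsq (X t - X 0)) Mt lo => fX Mt lo.
  move: (frobsq (F t - F 0)) Lt hi => fF Lt hi.
  set y := `|t| * _ in tt tl *.
  have y0 : 0 <= y by rewrite mulr_ge0 // sqrtr_ge0.
  have mR : 0 <= m%:R :> R by rewrite ler0n.
  rewrite ler_norml; apply/andP; split.
    have : K * fX <= K * (M * t ^+ 2) by rewrite ler_wpM2l.
    have : K * (M * t ^+ 2) <= K * (M * y) by rewrite !ler_wpM2l.
    have : 0 <= L * y by rewrite mulr_ge0.
    have : 0 <= m%:R * y by rewrite mulr_ge0.
    by move=> h1 h2 h3 h4; lra.
  have : - ln (t ^+ 2) * fF <= - ln (t ^+ 2) * (L * t ^+ 2).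
    by rewrite ler_wpM2l // oppr_ge0 ln_le0.
  have : L * (- ln (t ^+ 2) * t ^+ 2) <= L * (4 * y) by rewrite ler_wpM2l.
  have : m%:R * t ^+ 2 <= m%:R * y by rewrite ler_wpM2l.
  have : 0 <= K * M * y by rewrite !mulr_ge0.
  by move=> h1 h2 h3 h4; lra.
have [gd _] := mxderiv_trace (mxderivMr (hlog (X 0)) XD).
(* The entropy is the remainder r minus the linear functional g plus a constant; r has derivative 0,
   so only g contributes. *)
have -> : (fun t => vnentropy (X t)) =
    r - (fun t => complex.Re (\tr (X t *m hlog (X 0)))) + cst (vnentropy (X 0) + g 0).
  apply/funext => t.
  have trB (P Q : 'M[R[i]]_m) : \tr (P - Q) = \tr P - \tr Q by exact: linearB.
  change (vnentropy (X t) = r t - g t + (vnentropy (X 0) + g 0)).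
  rewrite /r /g mulmxBl trB RecB.
  have alg (a b c d : R) : a = (a - b + (c - d)) - c + (b + d) by ring.
  exact: alg.
apply: is_derive_eq (is_deriveD (is_deriveB rd gd) (is_derive_cst _ _ _)) _.
by rewrite addr0 sub0r.
Unshelve. all: by end_near. Qed.

(** * Bipartite vectors as coefficient matrices *)

Definition unvec (R : realType) (m n : nat) (psi : 'cV[R[i]]_(m * n)) : 'M[R[i]]_(m, n) :=
  \matrix_(i, j) psi (mxtens_index (i, j)) 0.

(** The reduced state of a pure state is a Gram matrix, so the derivative formula for Gram paths
    applies. *)
Lemma ptraceB_dens (R : realType) (m n : nat) (psi : 'cV[R[i]]_(m * n)) :
  ptraceB (dens psi) = unvec psi *m (unvec psi)^t*.
Proof.
apply/matrixP => i i'; rewrite !mxE; apply: eq_bigr => j _.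
by rewrite !mxE big_ord1 !mxE.
Qed.

Lemma sum_mxtens_index (V : nmodType) (m n : nat) (f : 'I_(m * n) -> V) :
  \sum_k f k = \sum_i \sum_j f (mxtens_index (i, j)).
Proof.
rewrite pair_big /= (reindex (@mxtens_index m n)) /=.
  by apply: eq_bigr => -[i j].
exists (@mxtens_unindex m n) => k _; [exact: mxtens_indexK|exact: mxtens_unindexK].
Qed.

Lemma inner_unvec (R : realType) (m n : nat) (u v : 'cV[R[i]]_(m * n)) :
  inner u v = \tr (unvec v *m (unvec u)^t*).
Proof.
rewrite /inner mxE sum_mxtens_index; apply: eq_bigr => i _; rewrite mxE.
by apply: eq_bigr => j _; rewrite !mxE mulrC.
Qed.

Lemma mxlogE (R : realType) (b : R) (n : nat) (A : 'M[R[i]]_n) :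
  mxlog b A = ((ln b)^-1)%:C *: hlog A.
Proof.
rewrite /mxlog /hlog !funcalcE scalemxAl scalemxAr; congr (_ *m _ *m _).
by apply/matrixP => i j; rewrite !mxE /logb mulrnAr mulrC -rmorphM.
Qed.

Lemma mxlog_adj (R : realType) (b : R) (n : nat) (A : 'M[R[i]]_n) :
  (mxlog b A)^t* = mxlog b A.
Proof.
rewrite /mxlog funcalc_adj.
have -> // : (fun x => @conjc R (logb b x)%:C) = fun x => (logb b x)%:C.
by apply/funext => x; exact: conjc_real.
Qed.

Lemma inner_conj (R : realType) (n : nat) (u v : 'cV[R[i]]_n) :
  inner u v = (inner v u)^*%C.
Proof.
rewrite /inner !mxE -conjcE rmorph_sum; apply: eq_bigr => k _.
by rewrite !mxE rmorphM mulrC; congr (_ * _); exact/esym/conjCK.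
Qed.

Lemma innerDr (R : realType) (n : nat) (u v w : 'cV[R[i]]_n) :
  inner u (v + w) = inner u v + inner u w.
Proof. by rewrite /inner mulmxDr mxE. Qed.

Lemma innerZr (R : realType) (n : nat) (c : R[i]) (u v : 'cV[R[i]]_n) :
  inner u (c *: v) = c * inner u v.
Proof. by rewrite /inner -scalemxAr mxE. Qed.

Lemma innerNr (R : realType) (n : nat) (u v : 'cV[R[i]]_n) :
  inner u (- v) = - inner u v.
Proof. by rewrite /inner mulmxN mxE. Qed.

Lemma innerDl (R : realType) (n : nat) (u v w : 'cV[R[i]]_n) :
  inner (u + v) w = inner u w + inner v w.
Proof. by rewrite /inner linearD /= map_mxD mulmxDl mxE. Qed.

Lemma innerNl (R : realType) (n : nat) (u w : 'cV[R[i]]_n) :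
  inner (- u) w = - inner u w.
Proof. by rewrite /inner linearN /= map_mxN mulNmx mxE. Qed.

Lemma innerZl (R : realType) (n : nat) (c : R[i]) (u w : 'cV[R[i]]_n) :
  inner (c *: u) w = c^*%C * inner u w.
Proof. by rewrite /inner linearZ /= map_mxZ -scalemxAl mxE. Qed.

Lemma entanglement_dens (R : realType) (b : R) (m n : nat) (psi : 'cV[R[i]]_(m * n)) :
  entanglement b (dens psi) = (ln b)^-1 * vnentropy (unvec psi *m (unvec psi)^t*).
Proof.
rewrite /entanglement ptraceB_dens; move: (unvec psi *m _) => A.
rewrite mxlogE -scalemxAr linearZ /= /vnentropy RecM /=; ring.
Qed.

(** * Unitary evolution and the formula for the rate *)

Lemma expiH_adj (R : realType) (n : nat) (s : R) (H : 'M[R[i]]_n) :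
  (expiH (- s) H)^t* = expiH s H.
Proof.
rewrite /expiH funcalc_adj.
have -> // : (fun x => (cos (- s * x) +i* sin (- s * x))^*%C) =
             (fun x => cos (s * x) +i* sin (s * x)) :> (R -> R[i]).
by apply/funext => x; rewrite mulNr cosN sinN /= opprK.
Qed.

Lemma expiH_adjK (R : realType) (n : nat) (s : R) (H : 'M[R[i]]_n) :
  (expiH s H)^t* *m expiH s H = 1%:M.
Proof.
rewrite /expiH funcalc_adj funcalcM -[RHS](funcalc1 H).
have -> // : (fun x => (cos (s * x) +i* sin (s * x))^*%C *
     (cos (s * x) +i* sin (s * x))) = (fun=> 1) :> (R -> R[i]).
apply/funext => x; rewrite -nsqEC /nsq /= cos2Dsin2 //.
Qed.

Lemma expiH0 (R : realType) (n : nat) (H : 'M[R[i]]_n) : expiH 0 H = 1%:M.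
Proof.
rewrite /expiH -[RHS](funcalc1 H).
have -> // : (fun x => cos (0 * x) +i* sin (0 * x)) = (fun=> 1) :> (R -> R[i]).
by apply/funext => x; rewrite mul0r cos0 sin0.
Qed.

Lemma evolve_dens (R : realType) (n : nat) (H : 'M[R[i]]_n) (psi : 'cV[R[i]]_n) t :
  evolve H (dens psi) t = dens (expiH (- t) H *m psi).
Proof. by rewrite /evolve /dens adjmxM expiH_adj !mulmxA. Qed.

Lemma inner_unitary (R : realType) (n : nat) (U : 'M[R[i]]_n) (u v : 'cV[R[i]]_n) :
  U^t* *m U = 1%:M -> inner (U *m u) (U *m v) = inner u v.
Proof. by move=> UU; rewrite /inner adjmxM -mulmxA (mulmxA _ U) UU mul1mx. Qed.

Lemma cderiv_cis (R : realType) (x : R) :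
  cderiv (fun t => cos (- t * x) +i* sin (- t * x)) (- 'i%C * x%:C).
Proof.
have lin : is_derive (0 : R) 1 (fun t : R => - t * x) (- x).
  have -> : (fun t : R => - t * x) = (- x) \*: id.
    by apply/funext => t; rewrite /= /GRing.scale /= mulNr mulrC mulNr.
  by apply: is_derive_eq; rewrite /GRing.scale /= mulr1.
split => /=.
  apply: is_derive_eq (is_derive1_comp (is_derive_cos _) lin) _.
  by rewrite oppr0 mul0r sin0; ring.
apply: is_derive_eq (is_derive1_comp (is_derive_sin _) lin) _.
by rewrite oppr0 mul0r cos0; ring.
Qed.

(** The eigenbasis of H does not depend on t, so only the diagonal phases are differentiated. *)
Lemma mxderiv_expiH (R : realType) (n : nat) (H : 'M[R[i]]_n) :
  H \is hermsymmx -> mxderiv (fun t => expiH (- t) H) (- 'i%C *: H).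
Proof.
move=> hH; rewrite {2}(herm_spectralE hH).
set S := spectralmx H; set D := diag_mx _.
have -> : (fun t => expiH (- t) H) = fun t =>
    S^t* *m diag_mx (\row_k (cos (- t * eigval H k) +i* sin (- t * eigval H k))) *m S.
  by apply/funext => t; rewrite /expiH funcalcE.
rewrite scalemxAl scalemxAr.
apply: mxderivMr; apply: mxderivMl => i j.
under eq_fun do rewrite !mxE; rewrite !mxE.
case: (i == j); last by rewrite mulr0n mulr0; exact: cderiv_cst.
rewrite !mulr1n; exact: cderiv_cis.
Qed.

(** Here phi is (log rho_A (x) 1) psi. The two product-rule terms of the trace are conjugate and add
    up to 2 Re <phi|- i H psi> = 2 Im <phi|H psi>. *)
Lemma is_derive_entanglement_path (R : realType) (b : R) (m n : nat)
    (psi phi : 'cV[R[i]]_(m * n)) (H : 'M[R[i]]_(m * n)) :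
  H \is hermsymmx ->
  unvec phi = mxlog b (unvec psi *m (unvec psi)^t*) *m unvec psi ->
  is_derive (0 : R) 1 (entanglement_path b psi H)
    (- 2 * complex.Im (inner phi (H *m psi))).
Proof.
move=> hH phiE; pose N := unvec psi; pose F t := unvec (expiH (- t) H *m psi).
have F0 : F 0 = N by rewrite /F oppr0 expiH0 mul1mx.
pose D : 'cV[R[i]]_(m * n) := (- 'i%C *: H) *m psi.
have FD : mxderiv F (unvec D).
  move=> i j; under eq_fun do rewrite mxE; rewrite mxE.
  exact: (mxderivMr psi (mxderiv_expiH hH)).
have trF t : \tr (F t *m (F t)^t*) = \tr (F 0 *m (F 0)^t*).
  have E s : \tr (F s *m (F s)^t*) = inner psi psi.
    by rewrite /F -inner_unvec; apply: inner_unitary; exact: expiH_adjK.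
  exact: etrans (E t) (esym (E 0)).
have := is_derive_vnentropy_gram FD trF; rewrite F0 => d.
have -> : entanglement_path b psi H =
    (ln b)^-1 \*: (fun t => vnentropy (F t *m (F t)^t*)).
  apply/funext => t.
  by rewrite /entanglement_path evolve_dens entanglement_dens.
apply: is_derive_eq (is_deriveZ _ d) _.
rewrite /GRing.scale /= mulrN -/N.
set L := mxlog b _ in phiE; have LE : L = ((ln b)^-1)%:C *: hlog (N *m N^t*).
  exact: mxlogE.
have -> : (ln b)^-1 * complex.Re (\tr ((unvec D *m N^t* + N *m (unvec D)^t*)
    *m hlog (N *m N^t*))) =
    complex.Re (\tr ((unvec D *m N^t* + N *m (unvec D)^t*) *m L)).
  by rewrite LE -scalemxAr linearZ /= RecM /= mul0r subr0.
rewrite mulmxDl linearD /=.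
(* The Hermitian logarithm is absorbed into phi from either side, one for each product-rule term. *)
have L1 : L *m N = unvec phi by rewrite phiE.
have L2 : N^t* *m L = (unvec phi)^t* by rewrite -L1 adjmxM mxlog_adj.
rewrite -(mulmxA (unvec D)) L2 (mxtrace_mulC (N *m _)) mulmxA L1.
rewrite -(inner_unvec phi D) -(inner_unvec D phi) (inner_conj D) /D -scalemxAl innerZr.
by case: (inner phi (H *m psi)) => x y /=; ring.
Qed.

(** * Cauchy-Schwarz bound and an optimal Hamiltonian *)

Lemma inner_self (R : realType) (n : nat) (u : 'cV[R[i]]_n) :
  inner u u = (frobsq u)%:C.
Proof. by rewrite frobsqE mxtrace_mulC /mxtrace big_ord1. Qed.

Lemma inner_herm (R : realType) (n : nat) (H : 'M[R[i]]_n) (u v : 'cV[R[i]]_n) :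
  H \is hermsymmx -> inner (H *m u) v = inner u (H *m v).
Proof. by move=> hH; rewrite /inner adjmxM (hermE hH) mulmxA. Qed.

Lemma inner_cauchy_schwarz1 (R : realType) (n : nat) (u v : 'cV[R[i]]_n) :
  inner v v = 1 -> nsq (inner u v) <= frobsq u.
Proof.
move=> v1; have := frobsq_ge0 (u - inner v u *: v).
rewrite -lecR -inner_self innerDl innerNl innerZl !innerDr !innerNr !innerZr v1.
rewrite -(inner_conj u v) inner_self mulr1 subrr mulr0 subr0.
by rewrite (inner_conj v u) -nsqEC -rmorphB lecR subr_ge0.
Qed.

(** Subtracting from H psi its component along psi leaves a vector whose squared norm is the energy
    variance. The inner product with u is unchanged because u is orthogonal to psi. *)
Lemma Im_inner_herm_le (R : realType) (n : nat) (psi u : 'cV[R[i]]_n) (H : 'M[R[i]]_n) :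
  H \is hermsymmx -> inner psi psi = 1 -> inner u psi = 0 ->
  energy_variance psi H = 1 ->
  `|complex.Im (inner u (H *m psi))| <= Num.sqrt (frobsq u).
Proof.
move=> hH psi1 upsi var1; pose h := inner psi (H *m psi).
have hr : h^*%C = h by rewrite /h -inner_conj inner_herm.
pose v := H *m psi - h *: psi.
have v1 : inner v v = 1.
  rewrite /v innerDl innerNl innerZl !innerDr !innerNr !innerZr psi1 hr.
  rewrite !inner_herm // mulmxA -/h -[RHS]var1 /energy_variance -/h; ring.
have -> : inner u (H *m psi) = inner u v.
  by rewrite innerDr innerNr innerZr upsi mulr0 subr0.
rewrite -sqrtr_sqr ler_wsqrtr //.
apply: le_trans (inner_cauchy_schwarz1 u v1).
by rewrite /nsq lerDr sqr_ge0.
Qed.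

Lemma exists_herm_rotation (R : realType) (n : nat) (psi v : 'cV[R[i]]_n) :
  inner psi psi = 1 -> inner v v = 1 -> inner psi v = 0 ->
  exists H : 'M[R[i]]_n, [/\ H \is hermsymmx, energy_variance psi H = 1 &
    H *m psi = - 'i%C *: v].
Proof.
move=> psi1 v1 psiv.
(* The bracket is skew-Hermitian, so i times it is Hermitian. It sends psi to - i v, hence has mean
   0 and second moment |v|^2 = 1. *)
pose H := 'i%C *: (psi *m v^t* - v *m psi^t*).
have hH : H \is hermsymmx.
  apply/is_hermitianmxP; rewrite expr0 scale1r.
  have skew : (psi *m v^t* - v *m psi^t*)^t* = v *m psi^t* - psi *m v^t*.
    by rewrite linearB /= map_mxB !adjmxM !trmxCK.
  rewrite /H linearZ /= map_mxZ skew.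
  have ci : Num.conj ('i%C : R[i]) = - 'i%C by rewrite conjcE /= /GRing.opp /= oppr0.
  apply: (@etrans _ _ (- 'i%C *: (v *m psi^t* - psi *m v^t*))).
    by rewrite scaleNr -scalerN opprB.
  by congr (_ *: _); exact/esym/ci.
have dyad (x y z : 'cV[R[i]]_n) : x *m y^t* *m z = inner y z *: x.
  by rewrite -mulmxA (mx11_scalar (y^t* *m z)) mul_mx_scalar.
have Hpsi : H *m psi = - 'i%C *: v.
  rewrite -scalemxAl mulmxBl !dyad psi1 inner_conj psiv conjc0 scale0r sub0r.
  by rewrite scale1r scalerN scaleNr.
exists H; split => //.
rewrite /energy_variance -mulmxA -(inner_herm _ _ hH) Hpsi innerZl !innerZr psiv v1.
rewrite mulr0 expr2 mulr0 subr0 mulr1.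
by rewrite -nsqEC /nsq /= oppr0 expr0n /= add0r sqrrN expr1n.
Qed.

(** * Schmidt sums and the logarithm of the reduced state *)

Lemma inner_tens (R : realType) (m n : nat) (u u' : 'cV[R[i]]_m) (v v' : 'cV[R[i]]_n) :
  inner (u *t v : 'cV_(m * n)) (u' *t v') = inner u u' * inner v v'.
Proof.
rewrite /inner !mxE sum_mxtens_index mulr_suml; apply: eq_bigr => i _.
rewrite mulr_sumr; apply: eq_bigr => j _.
by rewrite !mxE !mxtens_indexK /= !ord1 rmorphM /=; ring.
Qed.

(** Arbitrary real coefficients let psi, phi and the centered vector u share one form. *)
Definition schmidt_sum (R : realType) (m n d : nat) (a : 'I_d -> 'cV[R[i]]_m)
    (e : 'I_d -> 'cV[R[i]]_n) (c : 'I_d -> R) : 'cV[R[i]]_(m * n) :=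
  \sum_i (c i)%:C *: (a i *t e i).

Lemma inner_sumr (R : realType) (n d : nat) (u : 'cV[R[i]]_n) (v : 'I_d -> 'cV[R[i]]_n) :
  inner u (\sum_i v i) = \sum_i inner u (v i).
Proof. by rewrite /inner mulmx_sumr summxE. Qed.

Lemma inner_suml (R : realType) (n d : nat) (u : 'cV[R[i]]_n) (v : 'I_d -> 'cV[R[i]]_n) :
  inner (\sum_i v i) u = \sum_i inner (v i) u.
Proof.
rewrite inner_conj inner_sumr rmorph_sum; apply: eq_bigr => i _.
exact/esym/inner_conj.
Qed.

Lemma inner_schmidt_sum (R : realType) (m n d : nat) (a : 'I_d -> 'cV[R[i]]_m)
    (e : 'I_d -> 'cV[R[i]]_n) (c c' : 'I_d -> R) :
  orthonormal_family a -> orthonormal_family e ->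
  inner (schmidt_sum a e c) (schmidt_sum a e c') = (\sum_i c i * c' i)%:C.
Proof.
move=> ha he; rewrite inner_suml rmorph_sum; apply: eq_bigr => i _.
rewrite innerZl conjc_real inner_sumr (bigD1 i) //= big1 ?addr0.
  by rewrite innerZr inner_tens ha he eqxx !mulr1 -rmorphM.
by move=> j ji; rewrite innerZr inner_tens ha eq_sym (negPf ji) mul0r mulr0.
Qed.

Lemma unvec_schmidt_sum (R : realType) (m n d : nat) (a : 'I_d -> 'cV[R[i]]_m)
    (e : 'I_d -> 'cV[R[i]]_n) (c : 'I_d -> R) :
  unvec (schmidt_sum a e c) = \sum_i (c i)%:C *: (a i *m (e i)^T).
Proof.
apply/matrixP => i j; rewrite mxE !summxE; apply: eq_bigr => k _.
by rewrite !mxE big_ord1 !mxE mxtens_indexK /= !ord1.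
Qed.

Lemma adjmxZ (R : realType) (m n : nat) (c : R[i]) (A : 'M[R[i]]_(m, n)) :
  (c *: A)^t* = c^*%C *: A^t*.
Proof. by apply/matrixP => i j; rewrite !mxE rmorphM. Qed.

Lemma adjmx_sum (R : realType) (m n d : nat) (A : 'I_d -> 'M[R[i]]_(m, n)) :
  (\sum_k A k)^t* = \sum_k (A k)^t*.
Proof.
apply/matrixP => i j; rewrite !mxE !summxE rmorph_sum.
by apply: eq_bigr => k _; rewrite !mxE.
Qed.

Lemma reduced_schmidt_eigen (R : realType) (m n d : nat) (a : 'I_d -> 'cV[R[i]]_m)
    (e : 'I_d -> 'cV[R[i]]_n) (c : 'I_d -> R) k :
  orthonormal_family a -> orthonormal_family e ->
  let N := unvec (schmidt_sum a e c) in
  N *m N^t* *m a k = (c k ^+ 2)%:C *: a k.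
Proof.
move=> ha he N; rewrite -mulmxA.
(* [((e k)^T)^t*] is the entrywise conjugate of [e k]; N maps it back to c_k a_k. *)
have -> : N^t* *m a k = (c k)%:C *: ((e k)^T)^t*.
  rewrite /N unvec_schmidt_sum adjmx_sum mulmx_suml (bigD1 k) // big1 => [|j jk].
    rewrite adjmxZ conjc_real adjmxM -scalemxAl -mulmxA (mx11_scalar (_ *m a k)).
    by rewrite -[X in X%:M]/(inner _ _) ha eqxx mulmx1; exact: addr0.
  rewrite adjmxZ adjmxM -scalemxAl -mulmxA (mx11_scalar (_ *m a k)).
  by rewrite -[X in X%:M]/(inner _ _) ha (negPf jk) mul_mx_scalar scale0r scaler0.
rewrite -scalemxAr /N unvec_schmidt_sum mulmx_suml.
have ee j : (e j)^T *m ((e k)^T)^t* = ((k == j)%:R)%:M :> 'M[R[i]]_1.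
  rewrite -he [LHS]mx11_scalar /inner !mxE; congr (_%:M).
  by apply: eq_bigr => l _; rewrite !mxE mulrC.
rewrite [(c k ^+ 2)%:C]rmorphXn /= expr2 -scalerA; congr (_ *: _).
rewrite (bigD1 k) // big1 => [|j jk].
  by rewrite -scalemxAl -mulmxA ee eqxx mulmx1; exact: addr0.
rewrite -scalemxAl -mulmxA ee eq_sym (negPf jk) mul_mx_scalar scale0r.
by rewrite scaler0.
Qed.

(** The columns of N are combinations of the eigenvectors a_k, on which the logarithm acts as log
    c_k^2. When c_k = 0 the corresponding term vanishes on both sides. *)
Lemma mxlog_schmidt (R : realType) (b : R) (m n d : nat) (a : 'I_d -> 'cV[R[i]]_m)
    (e : 'I_d -> 'cV[R[i]]_n) (c : 'I_d -> R) :
  orthonormal_family a -> orthonormal_family e ->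
  let N := unvec (schmidt_sum a e c) in
  unvec (schmidt_sum a e (fun k => c k * logb b (c k ^+ 2))) =
  mxlog b (N *m N^t*) *m N.
Proof.
move=> ha he N; rewrite {3}/N !unvec_schmidt_sum mulmx_sumr.
apply: eq_bigr => k _; rewrite -scalemxAr mulmxA.
rewrite (funcalc_eigenvector _ (gram_herm N) (reduced_schmidt_eigen c k ha he)).
by rewrite -scalemxAl scalerA -rmorphM.
Qed.

(** * The surprisal variance and the maximal rate *)

Lemma surprisal_variance_centered (R : realType) (b : R) (d : nat) (p : 'I_d -> R) :
  \sum_i p i = 1 ->
  surprisal_variance b p =
  \sum_i p i * (logb b (p i) - \sum_j p j * logb b (p j)) ^+ 2.
Proof.
move=> p1; rewrite /surprisal_variance; set mu := \sum_j p j * logb b (p j).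
under [RHS]eq_bigr => i _.
  have -> : p i * (logb b (p i) - mu) ^+ 2 =
    p i * logb b (p i) ^+ 2 + (- (2 * mu)) * (p i * logb b (p i)) + mu ^+ 2 * p i.
    by ring.
  over.
rewrite !big_split /= -!mulr_sumr p1 -/mu; ring.
Qed.

Lemma is_derive_entanglement_schmidt (R : realType) (b : R) (m n d : nat)
    (a : 'I_d -> 'cV[R[i]]_m) (e : 'I_d -> 'cV[R[i]]_n) (c : 'I_d -> R) (H : 'M[R[i]]_(m * n)) :
  orthonormal_family a -> orthonormal_family e -> H \is hermsymmx ->
  is_derive (0 : R) 1 (entanglement_path b (schmidt_sum a e c) H)
    (- 2 * complex.Im
      (inner (schmidt_sum a e (fun k => c k * logb b (c k ^+ 2)))
             (H *m schmidt_sum a e c))).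
Proof.
move=> ha he hH; apply: is_derive_entanglement_path => //.
exact: mxlog_schmidt.
Qed.

Unset Implicit Arguments.

Theorem mainTheorem3 (R : realType) (b : R) (hb : 1 < b)
    (dA dB : nat) (hd : (2 <= minn dA dB)%N)
    (a : 'I_(minn dA dB) -> 'cV[R[i]]_dA)
    (e : 'I_(minn dA dB) -> 'cV[R[i]]_dB)
    (ha : orthonormal_family a) (he : orthonormal_family e)
    (C : 'I_(minn dA dB) -> R) (hC : forall i, 0 <= C i)
    (psi : 'cV[R[i]]_(dA * dB))
    (hpsi : psi = \sum_(i < minn dA dB) (C i)%:C *: (a i *t e i))
    (hunit : inner psi psi = 1) :
  let p := fun i => C i ^+ 2 in
  let M := 2 * Num.sqrt (surprisal_variance b p) in
  let rates := [set ent_rate b psi H | H in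
    [set H : 'M[R[i]]_(dA * dB) |
      H \is hermsymmx /\ energy_variance psi H = 1]] in
  [/\ (* the rate is well defined *)
      forall H : 'M[R[i]]_(dA * dB), H \is hermsymmx ->
        derivable (entanglement_path b psi H) 0 1,
      (* M is the maximum of the rates *)
      rates M /\ ubound rates M &
      (* f(p) is the variance of log p_i under p *)
      [/\ forall i, 0 <= p i, \sum_(i < minn dA dB) p i = 1 &
        surprisal_variance b p =
          \sum_(i < minn dA dB)
            p i * (logb b (p i)
                   - \sum_(j < minn dA dB) p j * logb b (p j)) ^+ 2]].
Proof.
move=> p M rates.
pose mu := \sum_j p j * logb b (p j).
pose phi := schmidt_sum a e (fun k => C k * logb b (C k ^+ 2)).
(* Centering log p_k at its mean mu makes u the component of phi orthogonal to psi, with squared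
   norm f(p). *)
pose u := schmidt_sum a e (fun k => C k * (logb b (p k) - mu)).
have psiE : psi = schmidt_sum a e C by exact: hpsi.
have p0 i : 0 <= p i by exact: sqr_ge0.
have p1 : \sum_i p i = 1.
  by apply: complexI; rewrite -[RHS]hunit psiE inner_schmidt_sum.
have fE := surprisal_variance_centered b p1.
have phiE : phi = u + mu%:C *: psi.
  rewrite psiE /u /phi /schmidt_sum scaler_sumr -big_split; apply: eq_bigr => k _.
  rewrite scalerA -rmorphM -[RHS]scalerDl -rmorphD; congr (_%:C *: _).
  by rewrite /p; ring.
have uu : frobsq u = surprisal_variance b p.
  apply: complexI; rewrite -inner_self inner_schmidt_sum // fE; congr (_%:C).
  by apply: eq_bigr => i _; rewrite -/mu; move: (_ - mu) => x; rewrite /p; ring.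
have upsi : inner u psi = 0.
  rewrite psiE inner_schmidt_sum //.
  have -> : \sum_i C i * (logb b (p i) - mu) * C i =
            \sum_i (p i * logb b (p i) + - mu * p i).
    by apply: eq_bigr => i _; rewrite /p; ring.
  by rewrite big_split /= -mulr_sumr p1 mulr1 subrr.
have psiu : inner psi u = 0 by rewrite inner_conj upsi conjc0.
have dE H : H \is hermsymmx -> is_derive (0 : R) 1 (entanglement_path b psi H)
    (- 2 * complex.Im (inner phi (H *m psi))).
  by move=> hH; rewrite psiE; exact: is_derive_entanglement_schmidt.
have rateE H : H \is hermsymmx ->
    ent_rate b psi H = - 2 * complex.Im (inner phi (H *m psi)).
  by move=> hH; have [_ E] := dE H hH; rewrite /ent_rate derive1E.
have ImE H : H \is hermsymmx ->
    complex.Im (inner phi (H *m psi)) = complex.Im (inner u (H *m psi)).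
  move=> hH; rewrite phiE innerDl innerZl ImcD.
  (* The component along psi contributes mu <psi|H psi>, which is real since H is Hermitian. *)
  suff -> : complex.Im (mu%:C^*%C * inner psi (H *m psi)) = 0 by rewrite addr0.
  have : (inner psi (H *m psi))^*%C = inner psi (H *m psi).
    by rewrite -inner_conj inner_herm.
  case: (inner psi _) => x y /= [yN]; have -> : y = 0 by lra.
  by ring.
split; [by move=> H hH; have [] := dE H hH| |by []].
split; last first.
  move=> _ [H [hH var1] <-]; rewrite rateE // ImE //.
  have := Im_inner_herm_le hH hunit upsi var1; rewrite uu ler_norml => /andP[].
  by rewrite /M; lra.
have [v [v1 psiv uv]] : exists v, [/\ inner v v = 1, inner psi v = 0 &
    inner u v = (Num.sqrt (surprisal_variance b p))%:C].
  have [f0|f0] := eqVneq (surprisal_variance b p) 0.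
    have d0 : (0 < minn dA dB)%N by exact: leq_trans hd.
    pose i0 := Ordinal d0; pose i1 := Ordinal hd.
    have i01 : i0 != i1 by [].
    (* If f = 0 then u = 0 and any unit vector orthogonal to psi will do; an off-diagonal product
       vector exists because d >= 2. *)
    exists (a i0 *t e i1); split.
    - by rewrite inner_tens ha he !eqxx mulr1.
    - rewrite hpsi inner_suml big1 // => k _.
      rewrite innerZl inner_tens ha he.
      have [->|_] := eqVneq k i0; last by rewrite mul0r mulr0.
      by rewrite (negPf i01) !mulr0.
    - have -> : u = 0 by apply: frobsq_eq0; rewrite uu.
      by rewrite f0 sqrtr0 /inner trmx0 map_mx0 mul0mx mxE.
  have fgt0 : 0 < surprisal_variance b p.
    by rewrite lt_def f0 -uu frobsq_ge0.
  pose s := Num.sqrt (surprisal_variance b p).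
  have s0 : s != 0 by rewrite gt_eqF // sqrtr_gt0.
  have ss : surprisal_variance b p = s * s by rewrite -expr2 sqr_sqrtr // ltW.
  (* The normalized u gives equality in Cauchy-Schwarz. *)
  exists ((s^-1)%:C *: u); split.
  - rewrite innerZl innerZr conjc_real inner_self uu ss -!rmorphM.
    by have -> : s^-1 * (s^-1 * (s * s)) = 1 by field.
  - by rewrite innerZr psiu mulr0.
  - rewrite innerZr inner_self uu -/s ss -rmorphM; congr (_%:C).
    by field.
have [H [hH var1 Hpsi]] := exists_herm_rotation hunit v1 psiv.
(* H psi = - i v gives Im <u|H psi> = - sqrt f, and the factor -2 turns this into the maximum. *)
exists H; first by [].
rewrite rateE // ImE // Hpsi innerZr uv /M /=; ring.
Qed.
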